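(* Consider the symmetric dynamic monopolistic competition model with sluggish entry and exit ($dn/dt = s\cdot$(total industry profit), $s>0$, discount rate $\rho>0$) under general inverse demand and cost functions, with the notation and standing assumptions given in the context. Let $(\tilde x,\tilde n)$ be the static equilibrium of monopolistic competition, i.e. $\tilde x>0$, $\tilde n>1$, $p(\tilde x,\tilde n)\tilde x-c(\tilde x)=0$ and $p(\tilde x,\tilde n)+p_1(\tilde x,\tilde n)\tilde x-c'(\tilde x)=0$, and let $(x^{**},n^{**})$ be the symmetric steady state of the memoryless closed-loop solution, with associated output response $x_n=\partial x_i/\partial n$. If, with all functions evaluated at $(x^{**},n^{**})$, $$p_2\,s\,(x^{**})^2-(n^{**}-1)\,s\left[p+(p_1-p_2)x^{**}-c'(x^{**})\right]x_n>0,$$ then $x^{**}<\tilde x$, and the number of firms at the steady state of the memoryless closed-loop solution is larger than that at the static equilibrium: $n^{**}>\tilde n$.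
   Context: Model. At each time $t\ge 0$ there are $n(t)$ firms producing differentiated goods; firm $i$ chooses output $x_i(t)$, faces the inverse demand function $p_i(x_1,\dots,x_n)$ (symmetric across firms) and has cost $c(x_i)$, with $c'>0$, the cost $c$ including any fixed cost. Firm $i$ maximizes $\int_0^\infty e^{-\rho t}[x_ip_i-c(x_i)]\,dt$ subject to $\frac{dn}{dt}=s\left[\sum_{j=1}^n x_jp_j-\sum_{j=1}^n c(x_j)\right]$, where $\rho>0$ and $s>0$. The number of firms $n$ is treated as a continuous real variable. Functions are as smooth as needed. Notation at symmetric points. When all outputs equal $x$ and there are $n$ firms, write $p=p(x,n)$ for the price $p_i(x,\dots,x)$; $p_1=\partial p_i/\partial x_i$; $p_2=\partial p_i/\partial x_j$ ($j\ne i$); $p_{11}=\partial^2p_i/\partial x_i^2$; $p_{12}=\partial^2p_i/\partial x_i\partial x_j$; $p_{22}=\partial^2p_i/\partial x_j^2$; $p_{23}=\partial^2p_i/\partial x_j\partial x_k$ ($i,j,k$ distinct), all evaluated at the symmetric point and regarded as functions of $(x,n)$. Differentiation in $n$ follows the convention $\partial p/\partial n=p_2x$ (an additional firm adds one more output $x$), and $\partial p/\partial x=p_1+(n-1)p_2$. Standing assumptions: $p_1<0$, $p_2<0$, $|p_2|<|p_1|$; $p_2+p_{12}x<0$ (strategic substitutes); $p_2+p_{23}x<0$; $|p_2+p_{12}x|\ge|p_2+p_{23}x|$; $p-c'(x)>0$. Along the free entry locus $p(x,n)x-c(x)=0$ (over the range of outputs containing the static equilibrium and steady-state outputs) it is assumed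 that $p+p_1x+(n-1)p_2x-c'(x)<0$, so that along this locus $n$ is a function of $x$ with $\frac{dn}{dx}=-\frac{p+p_1x+(n-1)p_2x-c'(x)}{p_2x^2}<0$. At the steady state of the closed-loop solution it is assumed that $p+\frac{(p_1-p_2)[p_1+(n-1)p_2]}{p_1+(n-2)p_2}x-c'(x)>0$; in particular $p+(p_1-p_2)x-c'(x)>0$ there. Memoryless closed-loop steady state. With Hamiltonian $\hat{\mathcal H}_i=x_ip_i-c(x_i)+\lambda_i s\left[\sum_jx_jp_j-\sum_jc(x_j)\right]$, the conditions are $\partial\hat{\mathcal H}_i/\partial x_i=0$, $\partial^2\hat{\mathcal H}_i/\partial x_i^2<0$ and the adjoint condition $-\frac{\partial\hat{\mathcal H}_i}{\partial n}-\sum_{j\ne i}\frac{\partial\hat{\mathcal H}_i}{\partial x_j}\frac{\partial x_j}{\partial n}=\dot\lambda_i-\rho\lambda_i$, where $\partial x_j/\partial n$ is the response of a firm's output to $n$ obtained from differentiating its first order condition in $n$. A symmetric steady state is a triple $(x^{**},n^{**},\lambda^{**})$, $x^{**}>0$, $n^{**}>1$, with all functions evaluated at $(x^{**},n^{**})$: (i) $p\,x^{**}-c(x^{**})=0$; (ii) $p+p_1x^{**}-c'(x^{**})+\lambda^{**}s\,B=0$, where $B=p+p_1x^{**}+(n^{**}-1)p_2x^{**}-c'(x^{**})$; (iii) $-p_2(x^{**})^2-\lambda^{**}n^{**}s\,p_2(x^{**})^2-(n^{**}-1)\left[p_2x^{**}+\lambda^{**}sB\right]x_n=-\rho\lambda^{**}$,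 where $$x_n=-\frac1\Delta\left\{(1+\lambda^{**}s)(p_2+p_{12}x^{**})x^{**}+\lambda^{**}s\left[p_2+(n^{**}-1)p_{23}x^{**}\right]x^{**}\right\},$$ $$\Delta=2p_1+p_{11}x^{**}-c''(x^{**})+\lambda^{**}s\left[2p_1+p_{11}x^{**}+(n^{**}-1)p_{22}x^{**}-c''(x^{**})\right];$$ (iv) second order condition: $\Delta<0$. Existence and uniqueness of the static equilibrium and the steady state are presumed.
   Formalization: The formal theorem also assumes the strict second order condition 2p_1+p_11 x-c''<0 at the static equilibrium; without it the claim fails, since marginal profit p+p_1 x-c' may cross zero upward along the free entry locus, giving x** larger than the static output. *)

(* Defs.v *)
(* Real analysis on Stdlib's [R] with Coquelicot. *)
From Stdlib Require Export Reals.
From Coquelicot Require Export Coquelicot.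

Open Scope R_scope.

(* Inverse demand of a firm i when the number n of firms is a real number.
   Partial derivatives up to order two involve at most two distinct rivals j, k,
   so [P y z w x n] is p_i when i produces y, j produces z, k produces w, every
   other firm produces x, and there are n firms.  Symmetry across firms is
   expressed by using the same P for every i, and by [demand_rivals] and
   [demand_price_law] below. *)
Definition demand : Type := R -> R -> R -> R -> R -> R.

Section SymmetricPoint.
Context (P : demand) (x n : R).

Definition p : R := P x x x x n.
Definition p1 : R := Derive (fun y => P y x x x n) x.
Definition p2 : R := Derive (fun z => P x z x x n) x.
Definition p11 : R := Derive_n (fun y => P y x x x n) 2 x.
Definition p12 : R := Derive (fun y => Derive (fun z => P y z x x n) x) x.
Definition p22 : R := Derive_n (fun z => P x z x x n) 2 x.
Definition p23 : R := Derive (fun z => Derive (fun w => P x z w x n) x) x.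

Record smooth_demand_at : Prop := {
  smooth_p1 : locally x (fun y => ex_derive (fun t => P t x x x n) y);
  smooth_p2 : locally x (fun z => ex_derive (fun t => P x t x x n) z);
  smooth_p11 : ex_derive_n (fun y => P y x x x n) 2 x;
  smooth_p22 : ex_derive_n (fun z => P x z x x n) 2 x;
  smooth_p2_own : locally x (fun y => ex_derive (fun z => P y z x x n) x);
  smooth_p12 : ex_derive (fun y => Derive (fun z => P y z x x n) x) x;
  smooth_p3_rival : locally x (fun z => ex_derive (fun w => P x z w x n) x);
  smooth_p23 : ex_derive (fun z => Derive (fun w => P x z w x n) x) x
}.

End SymmetricPoint.

(* A region W of symmetric points (x, n) on which the model is considered; its
   vertical sections are intervals, since n varies continuously. *)
Record region (W : R -> R -> Prop) : Prop := {
  region_pos : forall x n, W x n -> 0 < x /\ 1 < n;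
  region_open : forall x n, W x n -> locally_2d W x n;
  region_section : forall x n1 n n2,
    W x n1 -> W x n2 -> n1 <= n <= n2 -> W x n
}.

(* The two laws give the derivatives of p and p1 as functions of (x, n):
   moving the common output x moves the firm's own output and its n - 1 rivals'
   outputs, and an additional firm adds one more output x, whence
   dp/dx = p1 + (n-1) p2, dp/dn = p2 x,
   dp1/dx = p11 + (n-1) p12, dp1/dn = p12 x.
   The laws are needed because n is not an integer. *)
Record demand_model (W : R -> R -> Prop) (P : demand) : Prop := {
  demand_rivals : forall y z w x n,
    0 < y -> 0 < z -> 0 < w -> 0 < x -> 1 < n -> P y z w x n = P y w z x n;
  demand_smooth : forall x n, W x n -> smooth_demand_at P x n;
  demand_price_law : forall x n, W x n ->
    differentiable_pt_lim (p P) x n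
      (p1 P x n + (n - 1) * p2 P x n) (p2 P x n * x);
  demand_p1_law : forall x n, W x n ->
    differentiable_pt_lim (p1 P) x n
      (p11 P x n + (n - 1) * p12 P x n) (p12 P x n * x)
}.

Record cost_model (c : R -> R) : Prop := {
  cost_derive : forall x, 0 < x -> ex_derive c x;
  cost_derive2 : forall x, 0 < x -> ex_derive_n c 2 x;
  cost_increasing : forall x, 0 < x -> 0 < Derive c x
}.

Record standing_assumptions_at (P : demand) (c : R -> R) (x n : R) : Prop := {
  own_effect_neg : p1 P x n < 0;
  cross_effect_neg : p2 P x n < 0;
  cross_lt_own : Rabs (p2 P x n) < Rabs (p1 P x n);
  strategic_substitutes : p2 P x n + p12 P x n * x < 0;
  cross_cross_neg : p2 P x n + p23 P x n * x < 0;
  cross_cross_le :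
    Rabs (p2 P x n + p12 P x n * x) >= Rabs (p2 P x n + p23 P x n * x);
  price_above_marginal_cost : p P x n - Derive c x > 0
}.

Definition zero_profit (P : demand) (c : R -> R) (x n : R) : Prop :=
  p P x n * x - c x = 0.

(* Own marginal profit at a symmetric point, rivals' outputs and n fixed. *)
Definition own_marginal_profit (P : demand) (c : R -> R) (x n : R) : R :=
  p P x n + p1 P x n * x - Derive c x.

(* The quantity B: effect of x_i on total industry profit. *)
Definition industry_marginal_profit (P : demand) (c : R -> R) (x n : R) : R :=
  p P x n + p1 P x n * x + (n - 1) * p2 P x n * x - Derive c x.

(* D is the range of outputs over which the free entry locus is considered. *)
Record free_entry_locus (W : R -> R -> Prop) (D : R -> Prop)
    (P : demand) (c : R -> R) : Prop := {
  range_interval : forall x y z, D x -> D z -> x <= y <= z -> D y;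
  locus_covers : forall x, D x -> exists n, W x n /\ zero_profit P c x n;
  locus_sign : forall x n, D x -> W x n -> zero_profit P c x n ->
    industry_marginal_profit P c x n < 0
}.

Definition static_equilibrium (P : demand) (c : R -> R) (x n : R) : Prop :=
  0 < x /\ 1 < n /\ zero_profit P c x n /\ own_marginal_profit P c x n = 0.

(* Second order condition for the firm's static problem: the second derivative
   in y of y * p_i - c y, rivals' outputs and n fixed, is negative. *)
Definition static_second_order_condition
    (P : demand) (c : R -> R) (x n : R) : Prop :=
  2 * p1 P x n + p11 P x n * x - Derive_n c 2 x < 0.

(* Second derivative of the Hamiltonian in the firm's own output. *)
Definition Delta (P : demand) (c : R -> R) (s x n lambda : R) : R :=
  2 * p1 P x n + p11 P x n * x - Derive_n c 2 x
  + lambda * s * (2 * p1 P x n + p11 P x n * x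
                  + (n - 1) * p22 P x n * x - Derive_n c 2 x).

(* Response of a firm's output to n, from its first order condition. *)
Definition x_n (P : demand) (c : R -> R) (s x n lambda : R) : R :=
  - (1 / Delta P c s x n lambda) *
  ((1 + lambda * s) * (p2 P x n + p12 P x n * x) * x
   + lambda * s * (p2 P x n + (n - 1) * p23 P x n * x) * x).

Record closed_loop_steady_state (P : demand) (c : R -> R) (s rho : R)
    (x n lambda : R) : Prop := {
  steady_output_pos : 0 < x;
  steady_firms : 1 < n;
  steady_zero_profit : zero_profit P c x n;
  steady_first_order :
    p P x n + p1 P x n * x - Derive c x
    + lambda * s * industry_marginal_profit P c x n = 0;
  steady_adjoint :
    - p2 P x n * x ^ 2 - lambda * n * s * p2 P x n * x ^ 2
    - (n - 1) * (p2 P x n * x + lambda * s * industry_marginal_profit P c x n)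
      * x_n P c s x n lambda
    = - rho * lambda;
  steady_second_order : Delta P c s x n lambda < 0
}.

(* Assumed at the closed-loop steady state; it implies
   p + (p1 - p2) x - c' > 0 there under the standing assumptions. *)
Definition steady_state_assumption
    (P : demand) (c : R -> R) (x n : R) : Prop :=
  p P x n
  + (p1 P x n - p2 P x n) * (p1 P x n + (n - 1) * p2 P x n)
    / (p1 P x n + (n - 2) * p2 P x n) * x
  - Derive c x > 0.

(* Main.v *)
Require Import Defs.
From Stdlib Require Import Lra Ranalysis5.

(** Write M for the own marginal profit p + p1 x - c' and B < 0 for the effect
of one firm's output on industry profit.  At the steady state the first order
condition is M = - lambda s B.  Substituting it into the adjoint equation gives
<<
lambda (rho - n s p2 x^2) = p2 x^2 - (n - 1) (p + (p1 - p2) x - c') x_n,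
>>
whose right side is positive by the condition of the theorem and whose left
factor is positive because p2 < 0.  So lambda > 0, and M > 0 at the steady
state ([steady_own_marginal_profit_pos]).

The static equilibrium and the steady state both lie on the free entry locus,
which is the graph of a function n(x) with dn/dx = - B / (p2 x^2) < 0
([entry_firms_derive]).  Hence it suffices to compare outputs.  Let
G(x) = M(x, n(x)).  At the static equilibrium M = 0, so B = (n - 1) p2 x and
dn/dx = - (n - 1) / x: along the locus each firm's rivals' total output
(n - 1) x is stationary there.  The strategic terms in G' therefore cancel and
G' = 2 p1 + p11 x - c'' < 0, the static second order condition.  Thus G
becomes negative just to the right of xt; if G were positive at some larger
output it would vanish in between ([zero_after_downcrossing]), giving a second
static equilibrium.  As G > 0 at xs, xs < xt, and ns > nt since n(x)
decreases. *)

(** * Calculus on curves *)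

(** Linearizing f(u, m(u)) = g(u) at x gives lx + ly m' = g'.  Continuity of m
does not bound the increment k of m by that of u, but the error of the
linearization is at most e max(|h|, |k|), and the part in |k| is absorbed on
the left once e is small compared with |ly|. *)
Lemma implicit_derive (f : R -> R -> R) (g m : R -> R) (x lx ly dg : R) :
  differentiable_pt_lim f x (m x) lx ly -> ly <> 0 ->
  is_derive g x dg -> continuity_pt m x ->
  locally x (fun u => f u (m u) = g u) ->
  is_derive m x ((dg - lx) / ly).
Proof.
intros Hf Hly Hg Hm Heq.
set (d := (dg - lx) / ly).
apply is_derive_Reals; apply is_derive_Reals in Hg.
intros eps Heps.
assert (Hl : 0 < Rabs ly) by now apply Rabs_pos_lt.
assert (Hd := Rabs_pos d).
(* The first bound lets the left side absorb the error in k; the second makes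
   the remaining error smaller than eps |h|. *)
set (e := Rmin (Rabs ly / 4) (eps * Rabs ly / (8 * (1 + Rabs d)))).
assert (He1 : e <= Rabs ly / 4) by apply Rmin_l.
assert (He2 : e * (8 * (1 + Rabs d)) <= eps * Rabs ly).
{ apply Rle_trans with (eps * Rabs ly / (8 * (1 + Rabs d)) * (8 * (1 + Rabs d))).
  - apply Rmult_le_compat_r; [lra | apply Rmin_r].
  - right; field; lra. }
assert (He : 0 < e).
{ apply Rmin_pos; [lra |].
  apply Rdiv_lt_0_compat; [now apply Rmult_lt_0_compat | lra]. }
destruct (Hf (mkposreal e He)) as [d1 H1]; simpl in H1.
destruct (Hg e He) as [d2 H2].
destruct (proj1 (continuity_pt_locally m x) Hm d1) as [d3 H3].
destruct Heq as [d4 H4].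
assert (Hd0 : 0 < Rmin (Rmin d1 d2) (Rmin d3 d4)).
{ repeat apply Rmin_pos; apply cond_pos. }
exists (mkposreal _ Hd0); intros h Hh0 Hh; simpl in Hh.
assert (Hh12 := Rlt_le_trans _ _ _ Hh (Rmin_l _ _)).
assert (Hh34 := Rlt_le_trans _ _ _ Hh (Rmin_r _ _)).
assert (Hh1 := Rlt_le_trans _ _ _ Hh12 (Rmin_l _ _)).
assert (Hh2 := Rlt_le_trans _ _ _ Hh12 (Rmin_r _ _)).
assert (Hh3 := Rlt_le_trans _ _ _ Hh34 (Rmin_l _ _)).
assert (Hh4 := Rlt_le_trans _ _ _ Hh34 (Rmin_r _ _)).
assert (Hball : forall r, Rabs h < r -> Rabs (x + h - x) < r).
{ intros r Hr; now replace (x + h - x) with h by ring. }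
assert (Hx := H4 x (ball_center x d4)); simpl in Hx.
assert (Hxh := H4 (x + h) (Hball _ Hh4)); simpl in Hxh.
assert (A1 := H1 (x + h) (m (x + h)) (Hball _ Hh1) (H3 _ (Hball _ Hh3))).
assert (A2 := H2 h Hh0 Hh2).
replace (x + h - x) with h in A1 by ring.
rewrite Hx, Hxh in A1.
set (k := m (x + h) - m x) in *.
assert (Hh' : 0 < Rabs h) by now apply Rabs_pos_lt.
assert (A3 : Rabs (g (x + h) - g x - dg * h) <= e * Rabs h).
{ replace (g (x + h) - g x - dg * h)
    with (((g (x + h) - g x) / h - dg) * h) by (field; exact Hh0).
  rewrite Rabs_mult; apply Rmult_le_compat_r; lra. }
assert (A4 : Rabs ly * Rabs (k - d * h)
             <= e * Rmax (Rabs h) (Rabs k) + e * Rabs h).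
{ rewrite <- Rabs_mult.
  replace (ly * (k - d * h)) with
    ((g (x + h) - g x - dg * h) - (g (x + h) - g x - (lx * h + ly * k)))
    by (unfold d; field; exact Hly).
  unfold Rminus at 1.
  eapply Rle_trans; [apply Rabs_triang |]; rewrite Rabs_Ropp; lra. }
assert (A5 : Rabs k <= Rabs (k - d * h) + Rabs d * Rabs h).
{ rewrite <- Rabs_mult; replace k with ((k - d * h) + d * h) at 1 by ring.
  apply Rabs_triang. }
assert (A6 : Rmax (Rabs h) (Rabs k)
             <= (1 + Rabs d) * Rabs h + Rabs (k - d * h)).
{ assert (H0 := Rabs_pos (k - d * h)).
  apply Rmax_lub; nra. }
replace (k / h - d) with ((k - d * h) / h) by (field; exact Hh0).
unfold Rdiv; rewrite Rabs_mult, Rabs_inv.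
apply Rmult_lt_reg_r with (Rabs h); [exact Hh' |].
rewrite Rmult_assoc, Rinv_l, Rmult_1_r by lra.
set (K := Rabs (k - d * h)) in *.
assert (HK : 0 <= K) by apply Rabs_pos.
assert (A7 : e * Rmax (Rabs h) (Rabs k)
             <= e * ((1 + Rabs d) * Rabs h + K))
  by (apply Rmult_le_compat_l; lra).
assert (A8 : e * K <= Rabs ly / 4 * K) by (apply Rmult_le_compat_r; lra).
assert (A9 : e * Rabs h <= e * (1 + Rabs d) * Rabs h).
{ apply Rmult_le_compat_r; [lra |]; nra. }
assert (A10 : e * (8 * (1 + Rabs d)) * Rabs h <= eps * Rabs ly * Rabs h)
  by (apply Rmult_le_compat_r; lra).
assert (A11 : 0 < eps * Rabs h) by (apply Rmult_lt_0_compat; lra).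
apply Rmult_lt_reg_l with (Rabs ly); [exact Hl |].
assert (A12 : 0 < Rabs ly * (eps * Rabs h)) by (apply Rmult_lt_0_compat; lra).
nra.
Qed.

Lemma zero_after_downcrossing (G : R -> R) (a b l : R) :
  a < b -> is_derive G a l -> G a = 0 -> l < 0 -> 0 < G b ->
  (forall t, a <= t <= b -> continuity_pt G t) ->
  exists z, a < z <= b /\ G z = 0.
Proof.
intros Hab HG Ha Hl Hb Hcont.
apply is_derive_Reals in HG.
destruct (HG (- l)) as [dl Hdl]; [lra |].
set (h := Rmin (dl / 2) ((b - a) / 2)).
assert (Hdl0 := cond_pos dl).
assert (Hh : 0 < h) by (apply Rmin_pos; lra).
assert (Hh1 : h <= dl / 2) by apply Rmin_l.
assert (Hh2 : h <= (b - a) / 2) by apply Rmin_r.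
assert (Hneg : G (a + h) < 0).
{ assert (A := Hdl h ltac:(lra) ltac:(rewrite Rabs_pos_eq; lra)).
  apply Rabs_def2 in A; destruct A as [A _]; rewrite Ha in A.
  assert (A' : (G (a + h) - 0) / h < 0) by lra.
  replace (G (a + h)) with ((G (a + h) - 0) / h * h) by (field; lra); nra. }
destruct (IVT_interv G (a + h) b) as [z [Hz Hz0]]; try assumption; try lra.
- intros t Ht; apply Hcont; lra.
- exists z; split; [lra | exact Hz0].
Qed.

Lemma derive_along_graph (f : R -> R -> R) (m : R -> R) (x lx ly dm : R) :
  differentiable_pt_lim f x (m x) lx ly -> is_derive m x dm ->
  is_derive (fun t => f t (m t)) x (lx + ly * dm).
Proof.
intros Hf Hm; apply is_derive_Reals.
replace (lx + ly * dm) with (lx * 1 + ly * dm) by ring.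
apply (derivable_pt_lim_comp_2d f (fun t => t) m); [exact Hf | |].
- apply derivable_pt_lim_id.
- now apply is_derive_Reals.
Qed.

Lemma derive_second_variable (f : R -> R -> R) (x y lx ly : R) :
  differentiable_pt_lim f x y lx ly -> is_derive (f x) y ly.
Proof.
intros Hf; apply is_derive_Reals.
replace ly with (lx * 0 + ly * 1) by ring.
apply (derivable_pt_lim_comp_2d f (fun _ => x) (fun t => t)); [exact Hf | |].
- apply derivable_pt_lim_const.
- apply derivable_pt_lim_id.
Qed.

Lemma derive_continuity_pt (f : R -> R) (x l : R) :
  is_derive f x l -> continuity_pt f x.
Proof.
intros Hf; apply continuity_pt_filterlim.
apply (ex_derive_continuous (K := R_AbsRing) (V := R_NormedModule)).
now exists l.
Qed.

(** * The free entry locus *)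

Lemma price_decreasing_in_firms (W : R -> R -> Prop) (P : demand)
    (c : R -> R) (x n1 n2 : R) :
  region W -> demand_model W P ->
  (forall x n, W x n -> standing_assumptions_at P c x n) ->
  W x n1 -> W x n2 -> n1 < n2 -> p P x n2 < p P x n1.
Proof.
intros hW hP hst H1 H2 Hlt.
assert (Hsec : forall n, n1 <= n <= n2 -> W x n)
  by (intros n Hn; exact (region_section W hW x n1 n n2 H1 H2 Hn)).
assert (Hder : forall n, n1 <= n <= n2 -> is_derive (p P x) n (p2 P x n * x)).
{ intros n Hn; eapply derive_second_variable.
  exact (demand_price_law W P hP x n (Hsec n Hn)). }
destruct (MVT_gen (p P x) n1 n2 (fun n => p2 P x n * x)) as [n [Hn Heq]];
  rewrite ?Rmin_left, ?Rmax_right in * by lra.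
- intros n Hn; apply Hder; lra.
- intros n Hn; eapply derive_continuity_pt; apply Hder; lra.
- destruct (region_pos W hW x n (Hsec n Hn)) as [Hx _].
  assert (Hp2 := cross_effect_neg _ _ _ _ (hst x n (Hsec n Hn))).
  assert (p2 P x n * x < 0) by nra.
  nra.
Qed.

(** Zero profit as price equal to average cost puts the locus in the form
f(x, n) = g(x), with f differentiable in two variables and g in one. *)
Lemma zero_profit_price (P : demand) (c : R -> R) (x n : R) :
  0 < x -> zero_profit P c x n <-> p P x n = c x / x.
Proof.
intros Hx; unfold zero_profit; split; intros H.
- replace (c x) with (p P x n * x) by lra; field; lra.
- rewrite H; field; lra.
Qed.

(** At a given output the price is strictly decreasing in the number of firms,
so it meets average cost at most once. *)
Lemma free_entry_unique (W : R -> R -> Prop) (P : demand) (c : R -> R)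
    (x n1 n2 : R) :
  region W -> demand_model W P ->
  (forall x n, W x n -> standing_assumptions_at P c x n) ->
  W x n1 -> zero_profit P c x n1 -> W x n2 -> zero_profit P c x n2 -> n1 = n2.
Proof.
intros hW hP hst W1 Z1 W2 Z2.
destruct (region_pos W hW x n1 W1) as [Hx _].
apply zero_profit_price in Z1; [| exact Hx].
apply zero_profit_price in Z2; [| exact Hx].
destruct (Rtotal_order n1 n2) as [Hlt | [Heq | Hgt]]; [| exact Heq |].
- assert (A := price_decreasing_in_firms W P c x n1 n2 hW hP hst W1 W2 Hlt); lra.
- assert (A := price_decreasing_in_firms W P c x n2 n1 hW hP hst W2 W1 Hgt); lra.
Qed.

(** Definite description turns the locus, given as a relation, into a function
defined on all of R; it is meaningful at outputs where the locus has a point. *)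
Definition entry_firms (W : R -> R -> Prop) (P : demand) (c : R -> R)
    (x : R) : R :=
  iota (fun n => W x n /\ zero_profit P c x n).

Lemma entry_firms_eq (W : R -> R -> Prop) (P : demand) (c : R -> R) (x n : R) :
  region W -> demand_model W P ->
  (forall x n, W x n -> standing_assumptions_at P c x n) ->
  W x n -> zero_profit P c x n -> entry_firms W P c x = n.
Proof.
intros hW hP hst HWn HZ; unfold entry_firms.
apply (iota_unique (V := R_CompleteNormedModule)).
- intros m [Wm Zm].
  exact (free_entry_unique W P c x m n hW hP hst Wm Zm HWn HZ).
- now split.
Qed.

Lemma average_cost_derive (c : R -> R) (x : R) :
  cost_model c -> 0 < x ->
  is_derive (fun u => c u / u) x ((Derive c x * x - c x) / x ^ 2).
Proof.
intros hc Hx.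
replace (Derive c x * x - c x) with (Derive c x * x - c x * 1) by ring.
apply (is_derive_div c (fun u => u)); [| | lra].
- apply Derive_correct; exact (cost_derive c hc x Hx).
- apply (is_derive_id (K := R_AbsRing)).
Qed.

(** The gap between average cost and price is negative slightly below n and
positive slightly above; both signs persist for outputs near x, and the
intermediate value theorem in n gives a point of the locus in between.  The
neighbourhood of x is two-sided because the region is open, so the locus can be
differentiated even at an end of the range of outputs. *)
Lemma free_entry_nearby (W : R -> R -> Prop) (P : demand) (c : R -> R)
    (x n : R) (eps : posreal) :
  region W -> demand_model W P -> cost_model c ->
  (forall x n, W x n -> standing_assumptions_at P c x n) ->
  W x n -> zero_profit P c x n ->
  locally x (fun u => exists m,
    W u m /\ zero_profit P c u m /\ Rabs (m - n) < eps).
Proof.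
intros hW hP hc hst HWn HZ.
destruct (region_pos W hW x n HWn) as [Hx _].
destruct (region_open W hW x n HWn) as [d Hd].
assert (Heps := cond_pos eps); assert (Hd0 := cond_pos d).
(* Half of each radius keeps the closed band [n - e, n + e] inside both open
   conditions. *)
set (e := Rmin (eps / 2) (d / 2)).
assert (He1 : e <= eps / 2) by apply Rmin_l.
assert (He2 : e <= d / 2) by apply Rmin_r.
assert (He : 0 < e) by (apply Rmin_pos; lra).
assert (Hband : forall u m, Rabs (u - x) < d -> n - e <= m <= n + e -> W u m).
{ intros u m Hu Hm; apply Hd; [exact Hu |].
  apply Rabs_lt_between'; lra. }
assert (Hcol : forall m, n - e <= m <= n + e -> W x m).
{ intros m Hm; apply Hband; [| exact Hm].
  rewrite Rminus_diag, Rabs_R0; exact Hd0. }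
set (gap := fun m u => c u / u - p P u m).
assert (Hgap : forall m, n - e <= m <= n + e -> continuity_pt (gap m) x).
{ intros m Hm; apply continuity_pt_minus.
  - exact (derive_continuity_pt _ _ _ (average_cost_derive c x hc Hx)).
  - eapply derive_continuity_pt.
    apply (derive_along_graph (p P) (fun _ => m) x _ _ 0
             (demand_price_law W P hP x m (Hcol m Hm))).
    apply (is_derive_const (K := R_AbsRing) (V := R_NormedModule)). }
assert (Hlow : gap (n - e) x < 0).
{ apply zero_profit_price in HZ; [| exact Hx]; unfold gap; rewrite <- HZ.
  assert (A := price_decreasing_in_firms W P c x (n - e) n hW hP hst
                 (Hcol (n - e) ltac:(lra)) HWn ltac:(lra)); lra. }
assert (Hhigh : 0 < gap (n + e) x).
{ apply zero_profit_price in HZ; [| exact Hx]; unfold gap; rewrite <- HZ.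
  assert (A := price_decreasing_in_firms W P c x n (n + e) hW hP hst
                 HWn (Hcol (n + e) ltac:(lra)) ltac:(lra)); lra. }
assert (Hlow0 : 0 < - gap (n - e) x) by lra.
generalize (proj1 (continuity_pt_locally _ _) (Hgap (n - e) ltac:(lra))
              (mkposreal _ Hlow0)); intros Llow.
generalize (proj1 (continuity_pt_locally _ _) (Hgap (n + e) ltac:(lra))
              (mkposreal _ Hhigh)); intros Lhigh.
assert (Lball : locally x (fun u => Rabs (u - x) < d)) by (exists d; easy).
generalize (filter_and _ _ Lball (filter_and _ _ Llow Lhigh)).
apply filter_imp; simpl; intros u [Hu [Glow Ghigh]].
apply Rabs_def2 in Glow; apply Rabs_def2 in Ghigh.
destruct (IVT_interv (fun m => gap m u) (n - e) (n + e)) as [m [Hm Hm0]];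
  [| lra | lra | lra |].
- intros m Hm; unfold gap; apply continuity_pt_minus.
  + apply continuity_pt_const; intros a b; reflexivity.
  + eapply derive_continuity_pt, derive_second_variable.
    exact (demand_price_law W P hP u m (Hband u m Hu Hm)).
- assert (HWm := Hband u m Hu Hm).
  exists m; split; [exact HWm | split].
  + apply zero_profit_price; [exact (proj1 (region_pos W hW u m HWm)) |].
    unfold gap in Hm0; lra.
  + apply Rabs_lt_between'; lra.
Qed.

Lemma entry_firms_derive (W : R -> R -> Prop) (P : demand) (c : R -> R)
    (x n : R) :
  region W -> demand_model W P -> cost_model c ->
  (forall x n, W x n -> standing_assumptions_at P c x n) ->
  W x n -> zero_profit P c x n ->
  is_derive (entry_firms W P c) x
    (- industry_marginal_profit P c x n / (p2 P x n * x ^ 2)).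
Proof.
intros hW hP hc hst HWn HZ.
destruct (region_pos W hW x n HWn) as [Hx _].
assert (Hp2 := cross_effect_neg _ _ _ _ (hst x n HWn)).
assert (Hn : entry_firms W P c x = n) by now apply entry_firms_eq.
replace (- industry_marginal_profit P c x n / (p2 P x n * x ^ 2))
  with (((Derive c x * x - c x) / x ^ 2 - (p1 P x n + (n - 1) * p2 P x n))
        / (p2 P x n * x)).
2: { unfold zero_profit in HZ; unfold industry_marginal_profit.
     replace (c x) with (p P x n * x) by lra; field; lra. }
apply (implicit_derive (p P) (fun u => c u / u)).
- rewrite Hn; exact (demand_price_law W P hP x n HWn).
- nra.
- now apply average_cost_derive.
- apply continuity_pt_locally; intros eps.
  generalize (free_entry_nearby W P c x n eps hW hP hc hst HWn HZ).
  apply filter_imp; intros u [m [Wm [Zm Hm]]].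
  now rewrite Hn, (entry_firms_eq W P c u m hW hP hst Wm Zm).
- generalize (free_entry_nearby W P c x n (mkposreal 1 Rlt_0_1)
                hW hP hc hst HWn HZ).
  apply filter_imp; intros u [m [Wm [Zm _]]].
  rewrite (entry_firms_eq W P c u m hW hP hst Wm Zm).
  apply zero_profit_price; [exact (proj1 (region_pos W hW u m Wm)) | exact Zm].
Qed.

(** * Marginal profit on the locus and at the steady state *)

(** The strategic term p2 + p12 x enters multiplied by m - 1 + x m', the
derivative of the rivals' total output (m - 1) x along the curve. *)
Lemma own_marginal_profit_derive (W : R -> R -> Prop) (P : demand)
    (c : R -> R) (m : R -> R) (x dm : R) :
  region W -> demand_model W P -> cost_model c -> W x (m x) ->
  is_derive m x dm ->
  is_derive (fun u => own_marginal_profit P c u (m u)) x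
    (2 * p1 P x (m x) + p11 P x (m x) * x - Derive_n c 2 x
     + (p2 P x (m x) + p12 P x (m x) * x) * (m x - 1 + x * dm)).
Proof.
intros hW hP hc HWm Hm.
destruct (region_pos W hW x (m x) HWm) as [Hx _].
assert (Dp := derive_along_graph _ _ _ _ _ _
                (demand_price_law W P hP x (m x) HWm) Hm).
assert (Dp1 := derive_along_graph _ _ _ _ _ _
                 (demand_p1_law W P hP x (m x) HWm) Hm).
assert (Dc : is_derive (Derive c) x (Derive_n c 2 x))
  by (apply Derive_correct; exact (cost_derive2 c hc x Hx)).
apply is_derive_Reals in Dp; apply is_derive_Reals in Dp1.
apply is_derive_Reals in Dc; apply is_derive_Reals.
assert (D := derivable_pt_lim_minus _ _ _ _ _
  (derivable_pt_lim_plus _ _ _ _ _ Dp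
     (derivable_pt_lim_mult _ _ _ _ _ Dp1 (derivable_pt_lim_id x))) Dc).
unfold own_marginal_profit.
unfold plus_fct, minus_fct, mult_fct, id in D.
match goal with |- derivable_pt_lim _ _ ?l =>
  match type of D with derivable_pt_lim _ _ ?l' =>
    replace l with l' by ring end end.
exact D.
Qed.

(** By the first order condition p2 x + lambda s B equals
- (p + (p1 - p2) x - c'), which makes the adjoint equation linear in lambda
with positive coefficient rho - n s p2 x^2.  Hence lambda > 0: entry, which
output discourages since B < 0, is valuable to the firm, and it holds its
output where M is still positive. *)
Lemma steady_own_marginal_profit_pos (P : demand) (c : R -> R)
    (s rho x n lambda : R) :
  0 < s -> 0 < rho -> p2 P x n < 0 ->
  industry_marginal_profit P c x n < 0 ->
  closed_loop_steady_state P c s rho x n lambda ->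
  p2 P x n * s * x ^ 2
  - (n - 1) * s * (p P x n + (p1 P x n - p2 P x n) * x - Derive c x)
    * x_n P c s x n lambda > 0 ->
  0 < own_marginal_profit P c x n.
Proof.
intros hs hrho Hp2 HB [Hx Hn _ Hfoc Hadj _] Hcond.
set (xn := x_n P c s x n lambda) in *.
set (B := industry_marginal_profit P c x n) in *.
set (K := p P x n + (p1 P x n - p2 P x n) * x - Derive c x) in *.
replace (p2 P x n * x + lambda * s * B) with (- K) in Hadj
  by (unfold K; lra).
assert (Hlam : lambda * (rho + n * s * (- p2 P x n * x ^ 2))
               = p2 P x n * x ^ 2 - (n - 1) * K * xn) by lra.
assert (Hpos : 0 < p2 P x n * x ^ 2 - (n - 1) * K * xn).
{ apply Rmult_lt_reg_l with s; lra. }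
assert (Hcoef : 0 < rho + n * s * (- p2 P x n * x ^ 2)).
{ assert (0 < x ^ 2) by now apply pow_lt.
  assert (0 < - p2 P x n * x ^ 2) by (apply Rmult_lt_0_compat; lra).
  assert (0 < n * s) by (apply Rmult_lt_0_compat; lra).
  assert (0 < n * s * (- p2 P x n * x ^ 2)) by now apply Rmult_lt_0_compat.
  lra. }
assert (Hl : 0 < lambda) by nra.
assert (0 < lambda * s) by now apply Rmult_lt_0_compat.
unfold own_marginal_profit; nra.
Qed.

Theorem mainTheorem3
  (P : demand) (c : R -> R) (s rho : R)
  (W : R -> R -> Prop) (D : R -> Prop)
  (xt nt xs ns lambda : R)
  (hs : 0 < s) (hrho : 0 < rho)
  (hW : region W)
  (hP : demand_model W P)
  (hc : cost_model c)
  (hstanding : forall x n, W x n -> standing_assumptions_at P c x n)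
  (hlocus : free_entry_locus W D P c)
  (* the static equilibrium *)
  (hDt : D xt) (hWt : W xt nt)
  (hstatic : static_equilibrium P c xt nt)
  (hstatic_soc : static_second_order_condition P c xt nt)
  (hstatic_unique : forall x n, W x n -> static_equilibrium P c x n ->
     x = xt /\ n = nt)
  (* the symmetric steady state of the memoryless closed-loop solution *)
  (hDs : D xs) (hWs : W xs ns)
  (hsteady : closed_loop_steady_state P c s rho xs ns lambda)
  (hsteady_unique : forall x n l, W x n ->
     closed_loop_steady_state P c s rho x n l ->
     x = xs /\ n = ns /\ l = lambda)
  (hsteady_assumption : steady_state_assumption P c xs ns)
  (hcond :
     p2 P xs ns * s * xs ^ 2
     - (ns - 1) * s
       * (p P xs ns + (p1 P xs ns - p2 P xs ns) * xs - Derive c xs)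
       * x_n P c s xs ns lambda > 0) :
  xs < xt /\ ns > nt.
Proof.
destruct hstatic as [Hxt [_ [HZt HMt]]].
assert (HZs := steady_zero_profit _ _ _ _ _ _ _ hsteady).
assert (HMs : 0 < own_marginal_profit P c xs ns).
{ apply (steady_own_marginal_profit_pos P c s rho xs ns lambda); try assumption.
  - exact (cross_effect_neg _ _ _ _ (hstanding xs ns hWs)).
  - exact (locus_sign W D P c hlocus xs ns hDs hWs HZs). }
set (m := entry_firms W P c).
assert (Hm : forall x, D x -> W x (m x) /\ zero_profit P c x (m x)).
{ intros x Hx; destruct (locus_covers W D P c hlocus x Hx) as [n [Wn Zn]].
  unfold m; rewrite (entry_firms_eq W P c x n hW hP hstanding Wn Zn).
  now split. }
assert (Hmt : m xt = nt) by now apply entry_firms_eq.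
assert (Hms : m xs = ns) by now apply entry_firms_eq.
set (dm := fun x => - industry_marginal_profit P c x (m x)
                    / (p2 P x (m x) * x ^ 2)).
assert (Hdm : forall x, D x -> is_derive m x (dm x)).
{ intros x Hx; destruct (Hm x Hx) as [Wx Zx].
  now apply entry_firms_derive. }
set (G := fun x => own_marginal_profit P c x (m x)).
assert (HG : forall x, D x -> is_derive G x
  (2 * p1 P x (m x) + p11 P x (m x) * x - Derive_n c 2 x
   + (p2 P x (m x) + p12 P x (m x) * x) * (m x - 1 + x * dm x))).
{ intros x Hx; apply (own_marginal_profit_derive W); try assumption.
  - exact (proj1 (Hm x Hx)).
  - now apply Hdm. }
assert (HGzero : forall x, D x -> G x = 0 -> x = xt).
{ intros x Hx Hx0; destruct (Hm x Hx) as [Wx Zx].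
  destruct (region_pos W hW x (m x) Wx) as [Hx1 Hx2].
  now apply (hstatic_unique x (m x) Wx). }
assert (HGt : G xt = 0) by (unfold G; now rewrite Hmt).
assert (HGs : 0 < G xs) by (unfold G; now rewrite Hms).
assert (Hslope : is_derive G xt
  (2 * p1 P xt nt + p11 P xt nt * xt - Derive_n c 2 xt)).
{ assert (A := HG xt hDt).
  replace (m xt - 1 + xt * dm xt) with 0 in A.
  - rewrite Hmt, Rmult_0_r, Rplus_0_r in A; exact A.
  - assert (Hp2 := cross_effect_neg _ _ _ _ (hstanding xt nt hWt)).
    unfold dm; rewrite Hmt.
    (* As M = 0 here, B reduces to the effect on rivals, so n' = - (n - 1) / x. *)
    replace (industry_marginal_profit P c xt nt)
      with ((nt - 1) * p2 P xt nt * xt)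
      by (unfold industry_marginal_profit; unfold own_marginal_profit in HMt; lra).
    field; lra. }
assert (Hlt : xs < xt).
{ destruct (Rtotal_order xs xt) as [Hlt | [Heq | Hgt]]; [exact Hlt | |].
  - rewrite Heq in HGs; lra.
  - exfalso.
    assert (HD : forall t, xt <= t <= xs -> D t)
      by (intros t Ht; exact (range_interval W D P c hlocus xt t xs hDt hDs Ht)).
    destruct (zero_after_downcrossing G xt xs _ Hgt Hslope HGt hstatic_soc HGs)
      as [z [Hz Hz0]].
    + intros t Ht; exact (derive_continuity_pt _ _ _ (HG t (HD t Ht))).
    + assert (z = xt) by (apply HGzero; [apply HD; lra | exact Hz0]); lra. }
split; [exact Hlt |].
assert (HD : forall t, xs <= t <= xt -> D t)
  by (intros t Ht; exact (range_interval W D P c hlocus xs t xt hDs hDt Ht)).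
destruct (MVT_gen m xs xt dm) as [t [Ht Heq]];
  rewrite ?Rmin_left, ?Rmax_right in * by lra.
- intros t Ht; apply Hdm, HD; lra.
- intros t Ht; eapply derive_continuity_pt, Hdm, HD; lra.
- rewrite Hmt, Hms in Heq.
  destruct (Hm t (HD t Ht)) as [Wt Zt].
  assert (HB := locus_sign W D P c hlocus t (m t) (HD t Ht) Wt Zt).
  assert (Hp2 := cross_effect_neg _ _ _ _ (hstanding t (m t) Wt)).
  destruct (region_pos W hW t (m t) Wt) as [Ht0 _].
  assert (Hneg : dm t < 0).
  { assert (0 < t ^ 2) by now apply pow_lt.
    assert (p2 P t (m t) * t ^ 2 < 0) by nra.
    unfold dm, Rdiv.
    assert (/ (p2 P t (m t) * t ^ 2) < 0) by now apply Rinv_lt_0_compat.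
    nra. }
  nra.
Qed.
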